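(* Let $a>0$, $b>0$ be constants, and let $f:\mathbb{R}^n\times[0,\infty)\to\mathbb{R}$ be a positive traveling wave solution of $$f_t=\Delta f+af-bf^3,$$ that is, a positive solution of the form $f(x,t)=v(x_1,x_2,\dots,x_n+\eta t)$ for some function $v:\mathbb{R}^n\to\mathbb{R}$, where $\eta$ is the wavespeed. Then $$|\nabla v|\ \le\ v\,\eta .$$
   Context: The equation $f_t=\Delta f+af-bf^3$ is the Newell-Whitehead equation on $\mathbb{R}^n$; $\nabla$ and $\Delta$ are the gradient and Laplacian in the space variable in $\mathbb{R}^n$, and $f_t$ is the time derivative.
   Formalization: The wavespeed η is assumed nonnegative: for η<0 the constant solution f=v=√(a/b) has the stated form but 0=|∇v|≤vη fails, and the inequality can never hold for positive v when η<0. *)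

(* Defs.v *)
From mathcomp Require Import all_boot all_order all_algebra.
From mathcomp Require Import all_classical all_reals all_analysis.

Set Implicit Arguments.
Unset Strict Implicit.
Unset Printing Implicit Defensive.

Import Order.TTheory GRing.Theory Num.Theory.
Import numFieldNormedType.Exports.

Local Open Scope ring_scope.
Local Open Scope classical_set_scope.

(* The space is R^(n+1), as 'rV[R]_n.+1, so that the last coordinate
   ord_max always exists. *)

Definition basis_vec (R : realType) (n : nat) (i : 'I_n.+1) : 'rV[R]_n.+1 :=
  delta_mx 0 i.

Definition partial (R : realType) (n : nat) (i : 'I_n.+1)
    (g : 'rV[R]_n.+1 -> R) (x : 'rV[R]_n.+1) : R :=
  'D_(basis_vec R i) g x.

Definition grad (R : realType) (n : nat) (g : 'rV[R]_n.+1 -> R)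
    (x : 'rV[R]_n.+1) : 'rV[R]_n.+1 :=
  \row_i partial i g x.

Definition laplacian (R : realType) (n : nat) (g : 'rV[R]_n.+1 -> R)
    (x : 'rV[R]_n.+1) : R :=
  \sum_i partial i (partial i g) x.

(* The library norm `|x| on row vectors is the sup norm, hence this one. *)
Definition euclidean_norm (R : realType) (n : nat) (x : 'rV[R]_n.+1) : R :=
  Num.sqrt (\sum_i x 0 i ^+ 2).

(* f is of class C^{2,1} on R^(n+1) x (0, +oo): the derivatives of order at
   most two in x and of order one in t exist and are jointly continuous.
   Existence is required separately because 'D_v and ^`() are total. *)
Record classC21 (R : realType) (n : nat) (f : 'rV[R]_n.+1 -> R -> R) : Prop :=
  ClassC21 {
    C21_derivable_x : forall (i : 'I_n.+1) x t, 0 < t ->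
      derivable (f^~ t) x (basis_vec R i) ;
    C21_derivable_xx : forall (i j : 'I_n.+1) x t, 0 < t ->
      derivable (partial i (f^~ t)) x (basis_vec R j) ;
    C21_derivable_t : forall x t, 0 < t -> derivable (f x) t 1 ;
    C21_continuous : forall x t, 0 < t ->
      {for (x, t), continuous (fun p : 'rV[R]_n.+1 * R => f p.1 p.2)} ;
    C21_continuous_x : forall (i : 'I_n.+1) x t, 0 < t ->
      {for (x, t), continuous
        (fun p : 'rV[R]_n.+1 * R => partial i (f^~ p.2) p.1)} ;
    C21_continuous_xx : forall (i j : 'I_n.+1) x t, 0 < t ->
      {for (x, t), continuous
        (fun p : 'rV[R]_n.+1 * R => partial j (partial i (f^~ p.2)) p.1)} ;
    C21_continuous_t : forall x t, 0 < t ->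
      {for (x, t), continuous
        (fun p : 'rV[R]_n.+1 * R => (f p.1)^`() p.2)}
  }.

(* Functions on R^(n+1) x [0, +oo) are represented by total functions of t
   whose values at t < 0 are irrelevant; the equation holds for t > 0. *)
Definition newell_whitehead_solution (R : realType) (n : nat) (a b : R)
    (f : 'rV[R]_n.+1 -> R -> R) : Prop :=
  classC21 f /\
  forall x t, 0 < t ->
    (f x)^`() t = laplacian (f^~ t) x + a * f x t - b * f x t ^+ 3.

Definition positive_solution (R : realType) (n : nat) (a b : R)
    (f : 'rV[R]_n.+1 -> R -> R) : Prop :=
  newell_whitehead_solution a b f /\ forall x t, 0 <= t -> 0 < f x t.

Definition traveling_wave (R : realType) (n : nat) (eta : R)
    (v : 'rV[R]_n.+1 -> R) (f : 'rV[R]_n.+1 -> R -> R) : Prop :=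
  forall x t, 0 <= t -> f x t = v (x + (eta * t) *: basis_vec R ord_max).

(* Main.v *)
Require Import Defs.
From mathcomp Require Import all_boot all_order all_algebra.
From mathcomp Require Import all_classical all_reals all_analysis.
From mathcomp Require Import ring lra.

(** Let k = eta / 2.  The profile v is a positive solution on the whole space of
      Lap v - eta v_n + a v - b v^3 = 0,
    and u = ln v - k y_n satisfies
      Lap u + |grad u|^2 = V   with   V = k^2 - a + b v^2.
    It is enough to show |grad u| <= k, because grad v = v (grad u + k e_n) has
    then length at most 2 k v = eta v.

    Two facts about V are used.  First, V <= k^2, that is b v^2 <= a
    ([sqr_le_of_elliptic]): at a maximum of (rho^2 - |y - y0|^2) v over a ball of
    radius rho the equation bounds b v^2, and rho tends to infinity.  Second, if
    u p - u q >= k |p - q| then ln v p >= ln v q, hence V p >= V q.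

    The bound |grad u| <= k follows from the equation and these two facts
    ([euclidean_norm_grad_le]).  A Bernstein argument would differentiate the
    equation, hence need third derivatives of u.  Doubling the variables needs
    two only.  For K > k and a small mu one shows, with r = |x - y|,
      u x - u y <= K r / (1 - r - mu^2 |y - y0|^2)
    wherever the denominator is positive; y = y0 and x -> y0 then give
    |grad u (y0)| <= K.  The denominator confines x and y to a bounded region.
    Near the boundary of that region the right-hand side exceeds L r, where L is
    a Lipschitz constant of u there, so that if the inequality fails, the
    difference of the two sides has a positive maximum at an interior point
    with x <> y ([doubling_max_exists]).

    At that point the first derivatives determine grad u x and grad u y.  The
    second derivative is tested along the moves x + (1 - tau) s e_i, y + s e_i;
    summed over i this compares (1 - tau)^2 Lap u x with Lap u y.  As |grad u x|
    is at least K and V <= k^2, the Laplacian of u at x is at most k^2 - K^2,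
    and shrinking the step of x produces a gain of order tau (K^2 - k^2).  The
    terms of the other sign come from the curvature of |x - y|, of order
    tau^2 / r, and from the localisation, of order mu r.  With tau proportional
    to lam r and mu to lam^2, the gain is of first order in lam and the losses
    are of second order ([doubling_arith]), so that a small lam gives a
    contradiction ([doubling_no_max]). *)

Set Implicit Arguments.
Unset Strict Implicit.
Unset Printing Implicit Defensive.

Import Order.TTheory GRing.Theory Num.Theory.
Import numFieldNormedType.Exports.

Local Open Scope classical_set_scope.
Local Open Scope ring_scope.

(** * Calculus along lines *)

(** If g2 > 0, then g1 is positive just to the right of 0 and the mean value
    theorem makes g exceed g 0. *)
Lemma second_derivative_test (R : realType) (g g1 : R -> R) (g2 : R) :
  (forall s, is_derive s (1 : R) g (g1 s)) -> is_derive 0 (1 : R) g1 g2 ->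
  (\forall s \near 0, g s <= g 0) -> g1 0 = 0 /\ g2 <= 0.
Proof.
move=> dg dg1 /nbhs_ballP[e /= e0 gmax].
have ball_e s : -e < s < e -> g s <= g 0.
  by move=> se; apply: gmax; rewrite /ball/= sub0r normrN ltr_norml.
have g10 : g1 0 = 0.
  have d0 : is_derive 0 (1 : R) g 0.
    apply: (@derive1_at_max R g (- e) e) => [||/=|t].
    - by rewrite ge0_cp// ltW.
    - by move=> t _; have [] := dg t.
    - by rewrite in_itv/= oppr_lt0 e0.
    - by rewrite in_itv/=; exact: ball_e.
  by rewrite -(@derive_val _ _ _ _ _ _ _ (dg 0)) (@derive_val _ _ _ _ _ _ _ d0).
split=> //; rewrite leNgt; apply/negP => g2_gt0.
have : (fun h : R => h^-1 *: (g1 (h + 0) - g1 0)) @ 0^' --> g2.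
  have [dv <-] := dg1.
  have := dv; rewrite /derivable /derive /=.
  by under [in X in cvg X -> _]eq_fun do rewrite scaler1;
    under [in X in _ -> _ --> X]eq_fun do rewrite scaler1.
move=> /cvgr_gt /(_ _ g2_gt0).
rewrite /dnbhs /within /= => /nbhs_ballP[d /= d0 dP].
have [m m0 [me md]] : exists2 m : R, 0 < m & m < e /\ m < d.
  exists (Num.min e d / 2); first by rewrite divr_gt0// lt_min e0.
  have mm : 0 < Num.min e d by rewrite lt_min e0.
  have h : Num.min e d / 2 < Num.min e d by lra.
  by split; apply: (lt_le_trans h); rewrite ge_min lexx ?orbT.
have gc : {within `[0, m], continuous g}.
  apply: derivable_within_continuous => t _; by have [] := dg t.
have [c] := @MVT R g g1 0 m m0 (fun x _ => dg x) gc.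
rewrite in_itv/= subr0 => /andP[c0 cm] E.
have := ball_e m; rewrite me (lt_trans _ m0) ?oppr_lt0// => /(_ isT).
rewrite -subr_le0 E leNgt => /negP; apply; apply: mulr_gt0 => //.
have := dP c; rewrite /ball/= sub0r normrN gtr0_norm// (lt_trans cm md).
rewrite addr0 g10 subr0 => /(_ isT); rewrite gt_eqF// => /(_ isT).
by rewrite /GRing.scale/= pmulr_rgt0// invr_gt0.
Qed.

Lemma is_derive_line (R : realType) (V : normedModType R) (g : V -> R)
    (x v : V) (a s : R) : derivable g (x + (a * s) *: v) v ->
  is_derive s (1 : R) (fun t => g (x + (a * t) *: v)) (a * 'D_v g (x + (a * s) *: v)).
Proof.
set p := x + _ => dgp.
have h0 : is_derive (a * (s - s)) (1:R) (fun h => g (h *: v + p)) ('D_v g p).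
  have -> : a * (s - s) = 0 by rewrite subrr mulr0.
  split.
    exact: (proj1 (@derivable1P R V _ g p v) dgp).
  rewrite /derive; set F1 := fun h => _; set F2 := fun h => _.
  suff -> : F1 = F2 by [].
  by apply/funext => h; rewrite /F1 /F2 /= scaler1 addr0 scale0r add0r.
have h1 : is_derive s (1 : R) (fun t : R => a * (t - s)) a.
  have := is_deriveZ a (is_derive_shift s (1 : R) (- s)).
  by rewrite [a *: 1]mulr1.
have := @is_derive1_comp R (fun h => g (h *: v + p)) (fun t : R => a * (t - s)) s _ _ h0 h1.
rewrite mulrC; congr (is_derive _ _ _ _); apply/funext => t /=.
by congr g; rewrite /p addrCA -scalerDl; congr (_ + _ *: _); ring.
Qed.

Lemma is_derive_of_line (R : realType) (V : normedModType R) (g : V -> R)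
    (x v : V) (d : R) :
  is_derive 0 (1 : R) (fun t => g (x + t *: v)) d -> is_derive x v g d.
Proof.
move=> [d1 d2].
have E : (fun h : R => h^-1 *: ((g \o shift x) (h *: v) - g x)) =
  (fun h : R => h^-1 *: (((fun t => g (x + t *: v)) \o shift 0) (h *: 1) -
    g (x + 0 *: v))).
  by apply/funext => h /=; rewrite scale0r !addr0 [h *: 1]mulr1 [_ + x]addrC.
by split; [rewrite /derivable E | rewrite /derive E].
Qed.

Lemma is_derive_scaledir (R : realType) (V : normedModType R) (g : V -> R)
    (x v : V) (c : R) : derivable g x v -> is_derive x (c *: v) g (c * 'D_v g x).
Proof.
move=> dg; apply: is_derive_of_line.
have h : is_derive 0 (1 : R) (fun t => g (x + (c * t) *: v)) (c * 'D_v g x).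
  by have := @is_derive_line _ _ g x v c 0; rewrite mulr0 scale0r addr0; apply.
suff -> : (fun t => g (x + t *: (c *: v))) =
  (fun t => g (x + (c * t) *: v)) by [].
by apply/funext => t; rewrite scalerA mulrC.
Qed.

Lemma line_mean_value (R : realType) (V : normedModType R) (g : V -> R)
    (x v : V) (a : R) : (forall y, derivable g y v) ->
  exists2 t : R, 0 <= t <= 1 &
    g (x + a *: v) - g x = a * 'D_v g (x + (a * t) *: v).
Proof.
move=> dg.
have dl (t : R) : is_derive t (1 : R) (fun t => g (x + (a * t) *: v))
    (a * 'D_v g (x + (a * t) *: v)).
  exact: is_derive_line.
have cl : {within `[0, 1], continuous (fun t : R => g (x + (a * t) *: v))}.
  apply: derivable_within_continuous => t _; by have [] := dl t.
have [t] := @MVT R _ _ 0 1 ltr01 (fun t _ => dl t) cl.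
rewrite in_itv/= subr0 !mulr1 mulr0 scale0r addr0 => /andP[t0 t1] E.
by exists t => //; rewrite !ltW.
Qed.

(** Additivity in the direction holds once one of the two partial derivatives
    is continuous: split the increment at x + h v and apply the mean value
    theorem to the second piece. *)
Lemma is_deriveDdir (R : realType) (V : normedModType R) (g : V -> R)
    (x v w : V) : derivable g x v -> (forall y, derivable g y w) ->
  {for x, continuous (fun y => 'D_w g y)} ->
  is_derive x (v + w) g ('D_v g x + 'D_w g x).
Proof.
move=> dv dw cw.
suff H : (fun h : R => h^-1 *: ((g \o shift x) (h *: (v + w)) - g x)) @ 0^'
    --> 'D_v g x + 'D_w g x.
  split; first by apply/cvg_ex; eexists; exact: H.
  exact: cvg_lim H.
have -> : (fun h : R => h^-1 *: ((g \o shift x) (h *: (v + w)) - g x)) =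
  (fun h : R => h^-1 *: ((g \o shift x) (h *: v) - g x)) \+
  (fun h : R => h^-1 *: (g (x + h *: v + h *: w) - g (x + h *: v))).
  apply/funext => h /=; rewrite -scalerDr; congr (_ *: _).
  rewrite scalerDr [_ + _ + x]addrC addrA [h *: v + x]addrC.
  by rewrite [RHS]addrC subrKA.
apply: cvgD; first exact: dv.
apply/cvgrPdist_lt => e e0.
move/cvgrPdist_lt : cw => /(_ e e0) /nbhs_ballP[d /= d0 dP].
have K0 : 0 < `|v| + `|w| + 1 by rewrite ltr_wpDl// addr_ge0.
rewrite near_withinE; apply/nbhs_ballP; exists (d / (`|v| + `|w| + 1)) => /=.
  by rewrite divr_gt0.
move=> h; rewrite /ball/= sub0r normrN => hd h0.
have [t /andP[t0 t1] ->] := @line_mean_value R V g (x + h *: v) w h dw.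
rewrite /GRing.scale/= mulKf//; apply: dP.
rewrite -ball_normE /= -[X in x - X]addrA opprD addrA subrr add0r normrN.
apply: (le_lt_trans (ler_normD _ _)).
rewrite !normrZ (ger0_norm t0).
apply: (@le_lt_trans _ _ (`|h| * (`|v| + `|w| + 1))); last first.
  by rewrite -ltr_pdivlMr.
rewrite mulrDr mulr1 -[leLHS]addr0 mulrDr lerD// lerD2l//.
by rewrite -mulrA ler_wpM2l// ler_piMl.
Qed.

(** Continuous partial derivatives suffice for the chain rule in every
    direction: add the coordinate directions one at a time. *)
Lemma is_derive_gradient (R : realType) (n : nat) (g : 'rV[R]_n.+1 -> R)
    (x z : 'rV[R]_n.+1) :
  (forall i y, derivable g y (basis_vec R i)) ->
  (forall i, continuous (partial i g)) ->
  is_derive x z g (\sum_i z 0 i * partial i g x).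
Proof.
move=> dg cg.
rewrite {1}[z]row_sum_delta.
elim: (index_enum _) => [|i r IH].
  rewrite !big_nil; split; last exact: derive0.
  exact: derivable0.
rewrite !big_cons addrC [X in is_derive _ _ _ X]addrC.
have dz y : is_derive y (z 0 i *: basis_vec R i) g (z 0 i * partial i g y).
  exact: is_derive_scaledir.
have [IH1 IH2] := IH; have [_ dzx] := dz x.
rewrite -IH2 -dzx; apply: is_deriveDdir; first exact: IH1.
  by move=> y; have [] := dz y.
have -> : (fun y => 'D_(z 0 i *: basis_vec R i) g y) =
   (fun y => z 0 i * partial i g y).
  by apply/funext => y; rewrite (@derive_val _ _ _ _ _ _ _ (dz y)).
exact: (cvgMl_tmp (cg i x)).
Qed.

Lemma is_derive_translate (R : realType) (V : normedModType R) (g : V -> R)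
    (x v c : V) : derivable g (x + c) v ->
  is_derive x v (fun y => g (y + c)) ('D_v g (x + c)).
Proof.
move=> dg; apply: is_derive_of_line.
have h : is_derive 0 (1 : R) (fun t => g (x + c + (1 * t) *: v)) (1 * 'D_v g (x + c)).
  by have := @is_derive_line _ _ g (x + c) v 1 0; rewrite mulr0 scale0r addr0; apply.
rewrite mul1r in h; suff -> : (fun t => g (x + t *: v + c)) =
  (fun t => g (x + c + (1 * t) *: v)) by [].
by apply/funext => t; rewrite mul1r addrAC.
Qed.

Lemma is_derive_ln_comp (R : realType) (V : normedModType R) (g : V -> R)
    (x v : V) : 0 < g x -> derivable g x v ->
  is_derive x v (fun y => ln (g y)) ('D_v g x / g x).
Proof.
move=> g0 dg; apply: is_derive_of_line.
have h : is_derive 0 (1 : R) (fun t => g (x + t *: v)) ('D_v g x).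
  have := @is_derive_line _ _ g x v 1 0; rewrite mulr0 scale0r addr0 mul1r.
  move=> /(_ dg); suff -> : (fun t => g (x + t *: v)) =
    (fun t => g (x + (1 * t) *: v)) by [].
  by apply/funext => t; rewrite mul1r.
have hl : is_derive (g (x + 0 *: v)) (1 : R) (@ln R) (g x)^-1.
  by rewrite scale0r addr0; exact: is_derive1_ln.
by have := @is_derive1_comp R _ _ _ _ _ hl h; rewrite mulrC.
Qed.

Lemma is_derive_quadratic (R : realType) (a0 a1 a2 s : R) :
  is_derive s (1 : R) (fun t => a0 + a1 * t + a2 * t ^+ 2) (a1 + 2 * a2 * s).
Proof.
have h1 := is_deriveZ a1 (is_derive_id s (1 : R)).
have h2 := is_deriveZ a2 (is_deriveX 2 (is_derive_id s (1 : R))).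
have h := is_deriveD (is_deriveD (is_derive_cst a0 s (1 : R)) h1) h2.
apply: is_derive_eq h _.
rewrite /GRing.scale/= expr1; ring.
Qed.

Lemma is_derive_coord (R : realType) (n : nat) (i j : 'I_n.+1)
    (x : 'rV[R]_n.+1) :
  is_derive x (basis_vec R i) (fun y : 'rV[R]_n.+1 => y 0 j) (i == j)%:R.
Proof.
apply: is_derive_of_line.
have h := is_derive_quadratic (x 0 j) (i == j)%:R 0 0.
rewrite mulr0 addr0 in h.
suff -> : (fun t : R => (x + t *: basis_vec R i) 0 j) =
  (fun t => x 0 j + (i == j)%:R * t + 0 * t ^+ 2) by [].
by apply/funext => t; rewrite !mxE eqxx/= mul0r addr0 mulrC eq_sym.
Qed.

(** The test for a maximum of u x - u y - K A / B under the simultaneous moves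
    x + al s w, y + be s w, where A and B are quadratic in s.  It is stated
    after multiplication by B, so that no quotient has to be differentiated. *)
Lemma doubling_line_test (R : realType) (V : normedModType R) (u : V -> R)
    (x y w : V) (al be M K a0 a1 a2 b0 b1 b2 : R) :
  (forall p, derivable u p w) ->
  (forall p, derivable (fun q => 'D_w u q) p w) ->
  (\forall s \near 0, (u (x + (al * s) *: w) - u (y + (be * s) *: w) - M) *
    (b0 + b1 * s + b2 * s ^+ 2) <= K * (a0 + a1 * s + a2 * s ^+ 2)) ->
  (u x - u y - M) * b0 = K * a0 ->
  (al * 'D_w u x - be * 'D_w u y) * b0 + (u x - u y - M) * b1 = K * a1 /\
  (al ^+ 2 * 'D_w (fun q => 'D_w u q) x
    - be ^+ 2 * 'D_w (fun q => 'D_w u q) y) * b0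
  + 2 * (al * 'D_w u x - be * 'D_w u y) * b1 + 2 * (u x - u y - M) * b2
  <= 2 * K * a2.
Proof.
move=> du ddu nearle eq0.
pose D s := u (x + (al * s) *: w) - u (y + (be * s) *: w) - M.
pose D1 s := al * 'D_w u (x + (al * s) *: w) - be * 'D_w u (y + (be * s) *: w).
pose B (s : R) := b0 + b1 * s + b2 * s ^+ 2.
pose A (s : R) := a0 + a1 * s + a2 * s ^+ 2.
have dD s : is_derive s (1 : R) D (D1 s).
  have h := is_deriveB (is_deriveB (is_derive_line (du (x + (al * s) *: w)))
    (is_derive_line (du (y + (be * s) *: w)))) (is_derive_cst M s (1 : R)).
  by apply: is_derive_eq h _; rewrite subr0.
have dD1 : is_derive 0 (1 : R) D1
    (al ^+ 2 * 'D_w (fun q => 'D_w u q) x - be ^+ 2 * 'D_w (fun q => 'D_w u q) y).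
  have h := is_deriveB
    (is_deriveZ al (is_derive_line (s := 0) (ddu (x + (al * 0) *: w))))
    (is_deriveZ be (is_derive_line (s := 0) (ddu (y + (be * 0) *: w)))).
  apply: is_derive_eq h _.
  by rewrite /GRing.scale/= !mulr0 !mulrA -!expr2 ![_ 0 w]scale0r !addr0.
have dB s : is_derive s (1 : R) B (b1 + 2 * b2 * s) := is_derive_quadratic b0 b1 b2 s.
have dA s : is_derive s (1 : R) A (a1 + 2 * a2 * s) := is_derive_quadratic a0 a1 a2 s.
have dB1 : is_derive 0 (1 : R) (fun t => b1 + 2 * b2 * t) (2 * b2).
  have h := is_derive_quadratic b1 (2 * b2) 0 0.
  have {1}-> : (fun t : R => b1 + 2 * b2 * t) =
    (fun t => b1 + 2 * b2 * t + 0 * t ^+ 2) by apply/funext => t; ring.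
  by apply: is_derive_eq h _; ring.
have dA1 : is_derive 0 (1 : R) (fun t => a1 + 2 * a2 * t) (2 * a2).
  have h := is_derive_quadratic a1 (2 * a2) 0 0.
  have {1}-> : (fun t : R => a1 + 2 * a2 * t) =
    (fun t => a1 + 2 * a2 * t + 0 * t ^+ 2) by apply/funext => t; ring.
  by apply: is_derive_eq h _; ring.
pose g1 s := D1 s * B s + D s * (b1 + 2 * b2 * s) - K * (a1 + 2 * a2 * s).
have dg s : is_derive s (1 : R) (fun t => D t * B t - K * A t) (g1 s).
  have h := is_deriveB (is_deriveM (dD s) (dB s)) (is_deriveZ K (dA s)).
  by apply: is_derive_eq h _; rewrite /g1 /GRing.scale/=; ring.
have D0 : D 0 = u x - u y - M by rewrite /D !mulr0 !scale0r !addr0.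
have D10 : D1 0 = al * 'D_w u x - be * 'D_w u y.
  by rewrite /D1 !mulr0 !scale0r !addr0.
have B0 : B 0 = b0 by rewrite /B; ring.
have A0 : A 0 = a0 by rewrite /A; ring.
have dg1 := is_deriveB (is_deriveD (is_deriveM dD1 (dB 0))
  (is_deriveM (dD 0) dB1)) (is_deriveZ K dA1).
have [|g10 g20] := second_derivative_test dg dg1.
  rewrite D0 B0 A0 eq0 subrr; apply: filterS nearle => s.
  by rewrite -subr_le0.
split.
  by move: g10; rewrite /g1 D0 D10 B0 !mulr0 !addr0 => /eqP; rewrite subr_eq0 => /eqP.
move: g20; rewrite /GRing.scale/= D0 D10 B0 !mulr0 !addr0 => g20.
rewrite -subr_le0; apply: le_trans g20; rewrite le_eqVlt; apply/orP; left.
by apply/eqP; ring.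
Qed.

(** * The Euclidean norm *)

Definition sqnorm (R : realType) (n : nat) (x : 'rV[R]_n.+1) : R :=
  \sum_i x 0 i ^+ 2.

Lemma sqnorm_ge0 (R : realType) (n : nat) (x : 'rV[R]_n.+1) : 0 <= sqnorm x.
Proof. by apply: sumr_ge0 => i _; rewrite sqr_ge0. Qed.

Lemma euclidean_norm_ge0 (R : realType) (n : nat) (x : 'rV[R]_n.+1) :
  0 <= euclidean_norm x.
Proof. exact: sqrtr_ge0. Qed.

Lemma sqr_euclidean_norm (R : realType) (n : nat) (x : 'rV[R]_n.+1) :
  euclidean_norm x ^+ 2 = sqnorm x.
Proof. by rewrite sqr_sqrtr// sqnorm_ge0. Qed.

Lemma le_coord_euclidean_norm (R : realType) (n : nat) (x : 'rV[R]_n.+1) i :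
  `|x 0 i| <= euclidean_norm x.
Proof.
rewrite -sqrtr_sqr ler_wsqrtr// (bigD1 i)//= lerDl.
by apply: sumr_ge0 => j _; rewrite sqr_ge0.
Qed.

Lemma sqnormD_basis (R : realType) (n : nat) (x : 'rV[R]_n.+1) (s : R) i :
  sqnorm (x + s *: basis_vec R i) = sqnorm x + 2 * s * x 0 i + s ^+ 2.
Proof.
rewrite /sqnorm (bigD1 i)//= [in RHS](bigD1 i)//=.
under eq_bigr => j ji.
  rewrite !mxE (negPf ji) andbF mulr0 addr0; over.
by rewrite !mxE !eqxx mulr1; ring.
Qed.

Lemma sqnormZ (R : realType) (n : nat) (x : 'rV[R]_n.+1) (s : R) :
  sqnorm (s *: x) = s ^+ 2 * sqnorm x.
Proof. by rewrite /sqnorm mulr_sumr; apply: eq_bigr => i _; rewrite !mxE exprMn. Qed.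

Lemma sqnorm0 (R : realType) (n : nat) : sqnorm (0 : 'rV[R]_n.+1) = 0.
Proof. by rewrite /sqnorm big1// => i _; rewrite mxE expr0n. Qed.

Lemma cauchy_schwarz_sqnorm (R : realType) (n : nat) (x y : 'rV[R]_n.+1) :
  (\sum_i x 0 i * y 0 i) ^+ 2 <= sqnorm x * sqnorm y.
Proof.
set C := \sum_i _; have [y0|y0] := eqVneq (sqnorm y) 0.
  have yi i : y 0 i = 0.
    have := le_coord_euclidean_norm y i.
    have /eqP := sqr_euclidean_norm y; rewrite y0 sqrf_eq0 => /eqP ->.
    by rewrite normr_le0 => /eqP.
  rewrite y0 mulr0 /C big1 ?expr0n// => i _; by rewrite yi mulr0.
have yp : 0 < sqnorm y by rewrite lt_def y0 sqnorm_ge0.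
have : 0 <= \sum_i (sqnorm y * x 0 i - C * y 0 i) ^+ 2.
  by apply: sumr_ge0 => i _; rewrite sqr_ge0.
have -> : \sum_i (sqnorm y * x 0 i - C * y 0 i) ^+ 2 =
    sqnorm y ^+ 2 * sqnorm x - 2 * sqnorm y * C * C + C ^+ 2 * sqnorm y.
  transitivity (\sum_i (sqnorm y ^+ 2 * x 0 i ^+ 2
      - 2 * sqnorm y * C * (x 0 i * y 0 i) + C ^+ 2 * y 0 i ^+ 2)).
    by apply: eq_bigr => i _; ring.
  by rewrite big_split/= sumrB -!mulr_sumr.
have -> : sqnorm y ^+ 2 * sqnorm x - 2 * sqnorm y * C * C + C ^+ 2 * sqnorm y =
   sqnorm y * (sqnorm x * sqnorm y - C ^+ 2) by ring.
by rewrite pmulr_rge0// subr_ge0.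
Qed.

Lemma continuous_sumr (R : realType) (T : topologicalType) (I : finType)
    (F : I -> T -> R) :
  (forall i, continuous (F i)) -> continuous (fun x => \sum_i F i x).
Proof.
move=> cF; elim: (index_enum I) => [|i r IH] x.
  under [X in continuous_at _ X]eq_fun do rewrite big_nil.
  exact: cvg_cst.
under [X in continuous_at _ X]eq_fun do rewrite big_cons.
by apply: cvgD; [exact: cF | exact: IH].
Qed.

Lemma continuous_sqnorm (R : realType) (n : nat) :
  continuous (@sqnorm R n).
Proof.
apply: continuous_sumr => i x.
apply: (@continuousM _ _ (fun x : 'rV[R]_n.+1 => x 0 i) (fun x => x 0 i) x).
  exact: coord_continuous.
exact: coord_continuous.
Qed.

Lemma continuous_euclidean_norm (R : realType) (n : nat) :
  continuous (@euclidean_norm R n).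
Proof.
move=> x; apply: (@continuous_comp _ _ _ (@sqnorm R n) Num.sqrt).
  exact: continuous_sqnorm.
exact: sqrt_continuous.
Qed.

(** Cubes rather than Euclidean balls: products of segments are compact, and
    both convexity and membership are checked on coordinates. *)
Definition cube (R : realType) (n : nat) (rho : R) : set 'rV[R]_n.+1 :=
  [set x | forall i, - rho <= x 0 i <= rho].

Lemma compact_cube (R : realType) (n : nat) (rho : R) : compact (@cube R n rho).
Proof.
suff -> : @cube R n rho = [set v | forall i, `[- rho, rho]%classic (v ord0 i)].
  have := @rV_compact R n.+1 (fun=> `[- rho, rho]%classic)
    (fun=> @segment_compact _ _ _).
  exact.
by apply/seteqP; split => x xc i; have := xc i; rewrite /= in_itv.
Qed.

Lemma lipschitz_on_cube (R : realType) (n : nat) (g : 'rV[R]_n.+1 -> R)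
    (rho : R) : 0 <= rho ->
  (forall i y, derivable g y (basis_vec R i)) ->
  (forall i, continuous (partial i g)) ->
  exists2 L, 0 < L & forall x y, cube rho x -> cube rho y ->
    g x - g y <= L * euclidean_norm (x - y).
Proof.
move=> rho0 dg cg.
pose G x := \sum_i `|partial i g x|.
have cG : continuous G.
  by apply: continuous_sumr => i x; exact: (cvg_norm (cg i x)).
have [||c _ cmax] := @compact_EVT_max _ R G (@cube R n rho) _ (@compact_cube R n rho).
- by exists 0 => i; rewrite mxE oppr_le0 rho0.
- by apply: continuous_subspaceT => x; exact: cG.
exists (G c + 1) => [|x y xc yc].
  by rewrite ltr_wpDl//; apply: sumr_ge0.
have dz p := is_derive_gradient p (x - y) dg cg.
have [|t /andP[t0 t1]] := @line_mean_value _ _ g y (x - y) 1.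
  by move=> p; have [] := dz p.
rewrite scale1r subrKC mul1r => ->; rewrite mul1r.
set w := y + _; have [_ ->] := dz w.
have wc : cube rho w.
  move=> i; have := xc i; have := yc i; rewrite !mxE.
  by move=> /andP[? ?] /andP[? ?]; apply/andP; split; nra.
apply: (@le_trans _ _ (\sum_i euclidean_norm (x - y) * `|partial i g w|)).
  apply: ler_sum => i _; apply: (le_trans (ler_norm _)).
  by rewrite normrM ler_wpM2r// le_coord_euclidean_norm.
rewrite -mulr_sumr mulrC ler_wpM2r ?euclidean_norm_ge0//.
by apply: le_trans (cmax w _) _; rewrite ?inE// lerDl.
Qed.

(** * Upper bound for positive solutions *)

(** At a maximum y of th v, where th = rho^2 - |y - y0|^2 vanishes on the
    boundary of the ball, the first and second derivatives of v are controlled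
    by th^-1 v and th^-2 v.  The equation then gives
    b (th v)^2 <= a rho^4 + C rho^3 at y, hence rho^4 b v^2 <= a rho^4 + C rho^3
    at y0, for all rho >= 1. *)
Lemma sqr_le_of_elliptic (R : realType) (n : nat) (a b eta : R)
    (v : 'rV[R]_n.+1 -> R) :
  0 < a -> 0 < b -> 0 <= eta -> (forall y, 0 < v y) -> continuous v ->
  (forall i y, derivable v y (basis_vec R i)) ->
  (forall i y, derivable (partial i v) y (basis_vec R i)) ->
  (forall y, laplacian v y - eta * partial ord_max v y + a * v y
     - b * v y ^+ 3 = 0) ->
  forall y, b * v y ^+ 2 <= a.
Proof.
move=> a0 b0 eta0 v0 cv dv ddv eqv y0.
pose C := 8 + 2 * n.+1%:R + 2 * eta.
have C0 : 0 < C.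
  rewrite /C -addrA ltr_pwDl// addr_ge0 ?mulr_ge0//.
suff bound rho : 1 <= rho -> rho * (b * v y0 ^+ 2 - a) <= C.
  rewrite leNgt; apply/negP; rewrite -subr_gt0; set g := _ - a => g0.
  have := bound (1 + C / g); rewrite lerDl divr_ge0 ?(ltW C0) ?(ltW g0)// => /(_ isT).
  by rewrite mulrDl mul1r divfK ?gt_eqF// gerDr leNgt g0.
move=> rho1; have rho0 : 0 < rho by exact: lt_le_trans rho1.
pose th (y : 'rV[R]_n.+1) : R := rho ^+ 2 - sqnorm (y - y0).
have thle y : th y <= rho ^+ 2 by rewrite gerBl sqnorm_ge0.
have cy0 : continuous (fun y : 'rV[R]_n.+1 => y - y0).
  by move=> y; exact: (cvgB (@cvg_id _ (nbhs y)) (cvg_cst y0)).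
have csq : continuous (fun y : 'rV[R]_n.+1 => sqnorm (y - y0)).
  move=> y; apply: (@continuous_comp _ _ _ (fun y : 'rV[R]_n.+1 => y - y0) (@sqnorm R n)).
    exact: cy0.
  exact: continuous_sqnorm.
have cth : continuous th.
  by move=> y; exact: (cvgB (cvg_cst (rho ^+ 2)) (csq y)).
have nrho y : 0 <= th y -> euclidean_norm (y - y0) <= rho.
  rewrite subr_ge0 -sqr_euclidean_norm ler_sqr ?nnegrE ?euclidean_norm_ge0//.
  exact: ltW.
pose T : set 'rV[R]_n.+1 := [set y | 0 <= th y].
have cT : compact T.
  apply: (@subclosed_compact _ _ (@cube R n (rho + euclidean_norm y0))).
  - apply: (@closed_comp _ _ th [set t | 0 <= t]).
      by move=> p _; exact: cth.
    exact: closed_ge.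
  - exact: compact_cube.
  - move=> y yT i; rewrite -ler_norml.
    have -> : y 0 i = (y - y0) 0 i + y0 0 i by rewrite !mxE subrK.
    apply: (le_trans (ler_normD _ _)); apply: lerD.
      exact: le_trans (le_coord_euclidean_norm _ _) (nrho _ yT).
    exact: le_coord_euclidean_norm.
have thy0 : th y0 = rho ^+ 2.
  by rewrite /th subrr sqnorm0 subr0.
have y0T : T y0 by rewrite /T/= thy0 sqr_ge0.
have [||y yT ymax] := @compact_EVT_max _ R (fun y : 'rV[R]_n.+1 => th y * v y) T _ cT.
- by exists y0.
- by apply: continuous_subspaceT => y; exact: (cvgM (cth y) (cv y)).
move: yT; rewrite inE /T/= => thy.
pose W := th y * v y.
have W0 : rho ^+ 2 * v y0 <= W by rewrite -thy0; apply: ymax; rewrite inE.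
have W_gt0 : 0 < W by apply: lt_le_trans W0; rewrite mulr_gt0// exprn_gt0.
have thy0' : 0 < th y by move: W_gt0; rewrite /W pmulr_lgt0.
have Wmax z : th z * v z <= W.
  have [zT|zT] := leP 0 (th z); first by apply: ymax; rewrite inE.
  by apply: le_trans (ltW W_gt0); rewrite mulr_le0_ge0// ltW.
pose Y i := (y - y0) 0 i.
(* The line test with M = - v y and a constant right-hand side is the test for
   a maximum of th * v. *)
have [d1 d2] : (forall i, partial i v y * th y = 2 * Y i * v y) /\
   (forall i, partial i (partial i v) y * th y <=
     4 * Y i * partial i v y + 2 * v y).
  have main i := @doubling_line_test R _ v y y (basis_vec R i) 1 0 (- v y) W
     1 0 0 (th y) (- (2 * Y i)) (- 1) (dv i) (ddv i).
  have nle i : \forall s \near (0 : R), (v (y + (1 * s) *: basis_vec R i)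
       - v (y + (0 * s) *: basis_vec R i) - - v y) *
      (th y + - (2 * Y i) * s + - 1 * s ^+ 2) <= W * (1 + 0 * s + 0 * s ^+ 2).
    apply: filterE => s.
    rewrite mul0r scale0r addr0 opprK subrK mul1r !mul0r !addr0 mulr1.
    apply: le_trans (Wmax (y + s *: basis_vec R i)).
    have yE : y + s *: basis_vec R i - y0 = (y - y0) + s *: basis_vec R i.
      by rewrite addrAC.
    rewrite mulrC /th yE sqnormD_basis -/(Y i).
    by rewrite le_eqVlt; apply/orP; left; apply/eqP; ring.
  have eq0 : (v y - v y - - v y) * th y = W * 1 by rewrite /W; ring.
  split=> i; have [E1 E2] := main i (nle i) eq0.
    rewrite /partial; lra.
  rewrite /partial; lra.
have sum : laplacian v y * th y ^+ 2 <=
    8 * sqnorm (y - y0) * v y + n.+1%:R * (2 * v y * th y).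
  have -> : 8 * sqnorm (y - y0) * v y + n.+1%:R * (2 * v y * th y) =
    \sum_i (8 * v y * Y i ^+ 2 + 2 * v y * th y).
    rewrite big_split/= -mulr_sumr sumr_const card_ord mulr_natl.
    by congr (_ + _); rewrite /sqnorm -/Y; ring.
  rewrite /laplacian mulr_suml; apply: ler_sum => i _.
  have := ler_wpM2r thy (d2 i).
  have -> : (4 * Y i * partial i v y + 2 * v y) * th y =
    4 * Y i * (partial i v y * th y) + 2 * v y * th y by ring.
  by rewrite d1; lra.
have drift : - eta * partial ord_max v y * th y ^+ 2 <= 2 * eta * rho ^+ 3 * v y.
  have -> : - eta * partial ord_max v y * th y ^+ 2 =
     - (eta * (partial ord_max v y * th y) * th y) by ring.
  rewrite d1.
  have hY : - rho <= Y ord_max.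
    have := le_trans (le_coord_euclidean_norm (y - y0) ord_max) (nrho _ thy).
    by rewrite ler_norml => /andP[].
  have h1 : - (Y ord_max * th y) <= rho * rho ^+ 2.
    rewrite -mulNr; apply: (@le_trans _ _ (rho * th y)).
      by apply: ler_wpM2r => //; lra.
    by apply: ler_wpM2l => //; exact: ltW.
  have h2 : 0 <= 2 * eta * v y by rewrite !mulr_ge0// ltW.
  have := ler_wpM2l h2 h1; lra.
have vy := v0 y.
(* The equation times th^2, divided by v. *)
have key : b * W ^+ 2 <= a * rho ^+ 4 + C * rho ^+ 3.
  have e1 : v y * (b * W ^+ 2) = laplacian v y * th y ^+ 2
     + - eta * partial ord_max v y * th y ^+ 2 + a * v y * th y ^+ 2.
    by have := eqv y; rewrite /W; nra.
  rewrite -(ler_pM2l vy) e1.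
  have t1 : th y ^+ 2 <= rho ^+ 4.
    have -> : rho ^+ 4 = (rho ^+ 2) ^+ 2 by ring.
    by rewrite ler_sqr ?nnegrE ?sqr_ge0.
  have t2 : sqnorm (y - y0) <= rho ^+ 2 by rewrite -subr_ge0.
  have t3 : rho ^+ 2 <= rho ^+ 3.
    by rewrite exprS ler_peMl// sqr_ge0.
  have u1 : a * v y * th y ^+ 2 <= a * v y * rho ^+ 4.
    by apply: ler_wpM2l => //; rewrite mulr_ge0// ltW.
  have u2 : 8 * sqnorm (y - y0) * v y <= 8 * rho ^+ 3 * v y.
    apply: ler_wpM2r; first exact: ltW.
    by apply: ler_wpM2l => //; exact: le_trans t3.
  have u3 : n.+1%:R * (2 * v y * th y) <= n.+1%:R * (2 * v y * rho ^+ 3).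
    apply: ler_wpM2l => //; apply: ler_wpM2l; first by rewrite mulr_ge0// ltW.
    exact: le_trans t3.
  rewrite /C; lra.
have W2 : (rho ^+ 2 * v y0) ^+ 2 <= W ^+ 2.
  by rewrite ler_sqr ?nnegrE ?(ltW W_gt0)// mulr_ge0 ?sqr_ge0 ?(ltW (v0 _)).
have fin := le_trans (ler_wpM2l (ltW b0) W2) key.
have r3 : 0 < rho ^+ 3 by rewrite exprn_gt0.
rewrite -(ler_pM2l r3); lra.
Qed.

(** * Doubling of variables: the interior maximum *)

(** The denominator of the penalty.  Where it is nonnegative it bounds
    |x - y| by 1 and |y - y0| by 1 / mu, which makes the doubled problem compact. *)
Definition slack (R : realType) (n : nat) (mu : R) (y0 x y : 'rV[R]_n.+1) : R :=
  1 - euclidean_norm (x - y) - mu ^+ 2 * sqnorm (y - y0).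

Definition doubling (R : realType) (n : nat) (u : 'rV[R]_n.+1 -> R)
    (K mu : R) (y0 x y : 'rV[R]_n.+1) : R :=
  u x - u y - K * euclidean_norm (x - y) / slack mu y0 x y.

Lemma continuous_slack (R : realType) (n : nat) (mu : R) (y0 : 'rV[R]_n.+1) :
  continuous (fun p : 'rV[R]_n.+1 * 'rV[R]_n.+1 => slack mu y0 p.1 p.2).
Proof.
have c12 : continuous (fun p : 'rV[R]_n.+1 * 'rV[R]_n.+1 => p.1 - p.2).
  by move=> p; apply: cvgB; [exact: cvg_fst | exact: cvg_snd].
have c2 : continuous (fun p : 'rV[R]_n.+1 * 'rV[R]_n.+1 => p.2 - y0).
  by move=> p; apply: cvgB; [exact: cvg_snd | exact: cvg_cst].
move=> p; apply: cvgB.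
  apply: cvgB; first exact: cvg_cst.
  apply: (@continuous_comp _ _ _ (fun p : 'rV[R]_n.+1 * 'rV[R]_n.+1 => p.1 - p.2)
    (@euclidean_norm R n)); first exact: c12.
  exact: continuous_euclidean_norm.
apply: cvgMl_tmp.
apply: (@continuous_comp _ _ _ (fun p : 'rV[R]_n.+1 * 'rV[R]_n.+1 => p.2 - y0)
    (@sqnorm R n)); first exact: c2.
exact: continuous_sqnorm.
Qed.

Lemma continuous_doubling (R : realType) (n : nat) (u : 'rV[R]_n.+1 -> R)
    (K mu : R) (y0 : 'rV[R]_n.+1) (p : 'rV[R]_n.+1 * 'rV[R]_n.+1) :
  continuous u -> slack mu y0 p.1 p.2 != 0 ->
  {for p, continuous (fun p => doubling u K mu y0 p.1 p.2)}.
Proof.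
move=> cu sp; apply: cvgB.
  apply: cvgB.
    apply: (@continuous_comp _ _ _ fst u); first exact: cvg_fst.
    exact: cu.
  apply: (@continuous_comp _ _ _ snd u); first exact: cvg_snd.
  exact: cu.
apply: cvgM; last first.
  by apply: cvgV => //; exact: continuous_slack.
apply: cvgMl_tmp.
apply: (@continuous_comp _ _ _ (fun p : 'rV[R]_n.+1 * 'rV[R]_n.+1 => p.1 - p.2)
    (@euclidean_norm R n)); last exact: continuous_euclidean_norm.
by apply: cvgB; [exact: cvg_fst | exact: cvg_snd].
Qed.

Lemma slack_cube (R : realType) (n : nat) (mu : R) (y0 x y : 'rV[R]_n.+1) :
  0 < mu -> 0 <= slack mu y0 x y ->
  let rho := 1 + mu^-1 + euclidean_norm y0 in cube rho x /\ cube rho y.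
Proof.
move=> mu0 s0 rho.
have ny0 := euclidean_norm_ge0 y0.
have n1 : euclidean_norm (x - y) <= 1.
  have : 0 <= mu ^+ 2 * sqnorm (y - y0) by rewrite mulr_ge0 ?sqr_ge0 ?sqnorm_ge0.
  by move: s0; rewrite /slack; lra.
have n2 : euclidean_norm (y - y0) <= mu^-1.
  have s1 : mu ^+ 2 * sqnorm (y - y0) <= 1.
    have := euclidean_norm_ge0 (x - y).
    by move: s0; rewrite /slack; lra.
  rewrite -[leRHS]mul1r ler_pdivlMr// -ler_sqr ?nnegrE ?mulr_ge0 ?euclidean_norm_ge0 ?(ltW mu0)//.
  by rewrite exprMn sqr_euclidean_norm expr1n mulrC.
have hy i : `|y 0 i| <= mu^-1 + euclidean_norm y0.
  have -> : y 0 i = (y - y0) 0 i + y0 0 i by rewrite !mxE subrK.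
  apply: (le_trans (ler_normD _ _)); apply: lerD.
    exact: le_trans (le_coord_euclidean_norm _ _) n2.
  exact: le_coord_euclidean_norm.
split=> i; rewrite -ler_norml /rho.
  have -> : x 0 i = (x - y) 0 i + y 0 i by rewrite !mxE subrK.
  apply: (le_trans (ler_normD _ _)); rewrite -addrA; apply: lerD => //.
  exact: le_trans (le_coord_euclidean_norm _ _) n1.
by rewrite -addrA (le_trans (hy i))// lerDr.
Qed.

(** Where the slack is small the penalty exceeds the Lipschitz bound for u, so
    that a positive value can only occur on a compact region, and the maximum
    lies in its interior. *)
Lemma doubling_max_exists (R : realType) (n : nat) (u : 'rV[R]_n.+1 -> R)
    (K mu : R) (y0 x1 y1 : 'rV[R]_n.+1) :
  0 < K -> 0 < mu -> continuous u ->
  (forall i p, derivable u p (basis_vec R i)) ->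
  (forall i, continuous (partial i u)) ->
  0 < slack mu y0 x1 y1 -> 0 < doubling u K mu y0 x1 y1 ->
  exists x y, [/\ 0 < slack mu y0 x y, 0 < doubling u K mu y0 x y &
    \forall p \near ((x, y) : 'rV[R]_n.+1 * 'rV[R]_n.+1),
      doubling u K mu y0 p.1 p.2 <= doubling u K mu y0 x y].
Proof.
move=> K0 mu0 cu du cdu s1 D1.
pose rho := 1 + mu^-1 + euclidean_norm y0.
have rho0 : 0 <= rho by rewrite !addr_ge0 ?euclidean_norm_ge0// invr_ge0 ltW.
have [L L0 lipL] := lipschitz_on_cube rho0 du cdu.
(* K / th0 = K + L, so the penalty beats the Lipschitz bound once the slack is
   below th0; the maximum may be sought where the slack is at least th0. *)
pose th0 := K / (K + L).
have KL0 : 0 < K + L by rewrite addr_gt0.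
have th00 : 0 < th0 by rewrite divr_gt0.
have small x y : 0 < slack mu y0 x y -> slack mu y0 x y <= th0 ->
    doubling u K mu y0 x y <= 0.
  move=> sxy sth; have [xc yc] := slack_cube mu0 (ltW sxy).
  rewrite /doubling subr_le0; apply: (le_trans (lipL _ _ xc yc)).
  rewrite ler_pdivlMr// mulrAC; apply: ler_wpM2r; first exact: euclidean_norm_ge0.
  apply: (@le_trans _ _ (L * th0)); first by apply: ler_wpM2l => //; exact: ltW.
  rewrite /th0 mulrCA ler_piMr ?(ltW K0)// ler_pdivrMr// mul1r lerDr ltW//.
pose T : set ('rV[R]_n.+1 * 'rV[R]_n.+1) := [set p | th0 <= slack mu y0 p.1 p.2].
have cT : compact T.
  apply: (@subclosed_compact _ _ (@cube R n rho `*` @cube R n rho)).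
  - apply: (@closed_comp _ _ (fun p : 'rV[R]_n.+1 * 'rV[R]_n.+1 =>
      slack mu y0 p.1 p.2) [set t | th0 <= t]).
      by move=> p _; exact: continuous_slack.
    exact: closed_ge.
  - by apply: compact_setX; exact: compact_cube.
  - move=> p; rewrite /T/= => pT.
    by apply: slack_cube => //; apply: le_trans pT; exact: ltW.
have T1 : T (x1, y1).
  rewrite /T/= leNgt; apply/negP => /ltW h.
  by move: (small _ _ s1 h); rewrite leNgt D1.
have [||[x y] xyT xymax] := @compact_EVT_max _ R
   (fun p : 'rV[R]_n.+1 * 'rV[R]_n.+1 => doubling u K mu y0 p.1 p.2) T _ cT.
- by exists (x1, y1).
- apply: continuous_in_subspaceT => p; rewrite inE /T/= => pT.
  by apply: continuous_doubling => //; rewrite gt_eqF// (lt_le_trans th00).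
exists x, y.
move: xyT; rewrite inE /T/= => xyT.
have sxy : 0 < slack mu y0 x y by exact: lt_le_trans xyT.
have Dxy : 0 < doubling u K mu y0 x y.
  by apply: (lt_le_trans D1); apply: (xymax (x1, y1)); rewrite inE.
split=> //.
have sth : th0 < slack mu y0 x y.
  rewrite ltNge; apply/negP => h.
  by move: (small _ _ sxy h); rewrite leNgt Dxy.
have := @continuous_slack R n mu y0 (x, y).
move/cvgr_gt => /(_ _ sth); apply: filterS => p pth.
by apply: xymax; rewrite inE /T/= ltW.
Qed.

(** * Doubling of variables: the contradiction at the maximum *)

(** The distance |x' - y'| is at most (|x' - y'|^2 / r + r) / 2, with equality at
    the maximum point.  This majorant is quadratic along the moves and touches
    at the same point, so that the line test applies and no square root has to
    be differentiated. *)
Lemma doubling_line_at_max (R : realType) (n : nat) (u : 'rV[R]_n.+1 -> R)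
    (K mu al be : R) (y0 x y : 'rV[R]_n.+1) (i : 'I_n.+1) :
  let r := euclidean_norm (x - y) in
  let th := slack mu y0 x y in
  let e := (x - y) 0 i / r in
  let b1 := - ((al - be) * e) - 2 * mu ^+ 2 * be * (y - y0) 0 i in
  0 < K -> 0 < r -> 0 < th ->
  (forall p, derivable u p (basis_vec R i)) ->
  (forall p, derivable (partial i u) p (basis_vec R i)) ->
  (\forall s \near 0, doubling u K mu y0 (x + (al * s) *: basis_vec R i)
     (y + (be * s) *: basis_vec R i) <= doubling u K mu y0 x y) ->
  (al * partial i u x - be * partial i u y) * th + K * r / th * b1
    = K * ((al - be) * e) /\
  (al ^+ 2 * partial i (partial i u) x - be ^+ 2 * partial i (partial i u) y)
    * th + 2 * (al * partial i u x - be * partial i u y) * b1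
    - 2 * (K * r / th) * ((al - be) ^+ 2 / (2 * r) + mu ^+ 2 * be ^+ 2)
  <= 2 * K * ((al - be) ^+ 2 / (2 * r)).
Proof.
move=> r th e b1 K0 r0 th0 du ddu nmax.
pose M := doubling u K mu y0 x y.
pose a1 := (al - be) * e.
pose a2 := (al - be) ^+ 2 / (2 * r).
pose b2 := - (a2 + mu ^+ 2 * be ^+ 2).
have DM : u x - u y - M = K * r / th.
  by rewrite /M /doubling -/r -/th; ring.
have rn : r != 0 by rewrite gt_eqF.
have thn : th != 0 by rewrite gt_eqF.
have cB : \forall s \near (0 : R), 0 < th + b1 * s + b2 * s ^+ 2.
  have [dB _] := is_derive_quadratic th b1 b2 0.
  have cB : {for 0, continuous (fun s : R => th + b1 * s + b2 * s ^+ 2)}.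
    exact/differentiable_continuous/derivable1_diffP.
  move/cvgr_gt : cB; apply.
  by rewrite expr0n/= !mulr0 !addr0.
have nle : \forall s \near (0 : R),
    (u (x + (al * s) *: basis_vec R i) - u (y + (be * s) *: basis_vec R i) - M) *
    (th + b1 * s + b2 * s ^+ 2) <= K * (r + a1 * s + a2 * s ^+ 2).
  near=> s.
  have Bs : 0 < th + b1 * s + b2 * s ^+ 2 by near: s.
  have : doubling u K mu y0 (x + (al * s) *: basis_vec R i)
     (y + (be * s) *: basis_vec R i) <= M by near: s.
  rewrite /doubling.
  set x' := x + _; set y' := y + _.
  have xyE : x' - y' = (x - y) + ((al - be) * s) *: basis_vec R i.
    by rewrite /x' /y' opprD addrACA mulrBl scalerBl.
  have yE : y' - y0 = (y - y0) + (be * s) *: basis_vec R i.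
    by rewrite /y' addrAC.
  set r' := euclidean_norm (x' - y').
  have r'E : r' ^+ 2 = r ^+ 2 + 2 * ((al - be) * s) * (x - y) 0 i + ((al - be) * s) ^+ 2.
    by rewrite /r' !sqr_euclidean_norm xyE sqnormD_basis.
  pose As := r + a1 * s + a2 * s ^+ 2.
  have AE : As = (r' ^+ 2 + r ^+ 2) / (2 * r).
    by rewrite /As r'E /a1 /a2 /e; field.
  (* The arithmetic-geometric mean inequality r' <= (r'^2 + r^2) / (2 r). *)
  have rA : r' <= As.
    rewrite AE ler_pdivlMr ?mulr_gt0//.
    have := sqr_ge0 (r' - r); lra.
  have slE : slack mu y0 x' y' = th + b1 * s + b2 * s ^+ 2 + (As - r').
    rewrite /slack -/r' yE sqnormD_basis /th /slack -/r /b1 /b2 /As /a1; ring.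
  have sl0 : 0 < slack mu y0 x' y' by rewrite slE ltr_wpDr// subr_ge0.
  have r'0 : 0 <= r' by exact: euclidean_norm_ge0.
  move=> H.
  have : u x' - u y' - M <= K * r' / slack mu y0 x' y' by lra.
  move=> /le_trans H'; rewrite -ler_pdivlMr//; apply: H'.
  rewrite ler_pdivrMr// mulrAC ler_pdivlMr// -[K * r' * _]mulrA -[K * _ * _]mulrA.
  apply: ler_wpM2l; first exact: ltW.
  apply: ler_pM => //; first exact: ltW.
  by rewrite slE lerDl subr_ge0.
have eq0 : (u x - u y - M) * th = K * r by rewrite DM divfK.
have [E1 E2] := doubling_line_test du ddu nle eq0.
rewrite DM in E1 E2; split => //.
by apply: le_trans E2; rewrite /b2 mulrN.
Unshelve. all: by end_near. Qed.

Ltac nng := repeat (first [done | exact: sqr_ge0 | exact: ler0n | by apply: ltW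
  | by rewrite subr_ge0 | apply: mulr_ge0 | apply: addr_ge0 | apply: exprn_ge0]).

(** The inequality obtained by summing the second-order conditions is
    impossible.  In it m / th^2 times K is the length of the gradient at x, C and
    S stand for 2 mu^2 e.(y - y0) and 4 mu^4 |y - y0|^2, which are bounded by d
    and d^2, and eps is mu^2.  After multiplication by th^3, the gain is at least
    lam (K^2 - k^2) r m and each loss is at most a constant times lam^2 r m. *)
Lemma doubling_arith (R : realFieldType)
    (N K k lam d eps r m th tau C S Vx Vy : R) :
  0 <= N -> 0 <= k -> k < K -> 0 < lam -> lam <= 1 ->
  d = lam ^+ 2 -> 4 * eps = d ^+ 2 ->
  lam * (2 * K ^+ 2 + 8 * K + 3 * N * K) < K ^+ 2 - k ^+ 2 ->
  0 < th -> 0 < r -> m = th + r -> m <= 1 -> tau = lam * (r / m) ->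
  - d <= C <= d -> 0 <= S <= d ^+ 2 -> Vy <= Vx -> Vy <= k ^+ 2 ->
  th * ((1 - tau) ^+ 2 * (Vx - K ^+ 2 * m ^+ 2 / th ^+ 4)
     - (Vy - K ^+ 2 * (m ^+ 2 - 2 * r * m * C + r ^+ 2 * S) / th ^+ 4))
  + 2 * (K / th ^+ 2) * (- tau ^+ 2 * m + tau * m * C + r * tau * C - r * S)
  - N * K * (tau ^+ 2 + 2 * eps * r) / th <= N * K * tau ^+ 2 / r -> False.
Proof.
move=> N0 k0 kK l0 l1 dE epsE lsmall th0 r0 mE m1 tauE /andP[C1 C2]
  /andP[S1 S2] VV Vk H.
have K0 : 0 < K by exact: le_lt_trans kK.
have m0 : 0 < m by rewrite mE addr_gt0.
pose t := r / m.
have t0 : 0 < t by rewrite divr_gt0.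
have t1 : t <= 1 by rewrite ler_pdivrMr// mul1r mE lerDr ltW.
have rE : r = t * m by rewrite /t divfK// gt_eqF.
have thm : th <= m by rewrite mE lerDl ltW.
have d0 : 0 <= d by rewrite dE sqr_ge0.
have dl : d <= lam by rewrite dE expr2 ler_piMl// ltW//.
have e0 : 0 <= eps by nra.
have tau0 : 0 < tau by rewrite tauE mulr_gt0// divr_gt0.
rewrite -/t in tauE.
have tau1 : tau <= 1 by rewrite tauE mulr_ile1// ltW.
have thn : th != 0 by rewrite gt_eqF.
have rn : r != 0 by rewrite gt_eqF.
have mn : m != 0 by rewrite gt_eqF.
have {}H : (1 - tau) ^+ 2 * (Vx * th ^+ 4 - K ^+ 2 * m ^+ 2)
     - (Vy * th ^+ 4 - K ^+ 2 * (m ^+ 2 - 2 * r * m * C + r ^+ 2 * S))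
  + 2 * K * th * (- tau ^+ 2 * m + tau * m * C + r * tau * C - r * S)
  - N * K * th ^+ 2 * (tau ^+ 2 + 2 * eps * r) <= N * K * lam ^+ 2 * t * (th ^+ 3 / m).
  have th3 : 0 <= th ^+ 3 by rewrite exprn_ge0// ltW.
  have := ler_wpM2l th3 H.
  have -> : th ^+ 3 * (N * K * tau ^+ 2 / r) = N * K * lam ^+ 2 * t * (th ^+ 3 / m).
    by rewrite tauE rE; field; rewrite mn gt_eqF.
  apply: le_trans; rewrite le_eqVlt; apply/orP; left; apply/eqP; field.
  by rewrite thn.
have th4 : 0 <= th ^+ 4 by rewrite exprn_ge0// ltW.
have HV : - (2 * tau - tau ^+ 2) * k ^+ 2 * th ^+ 4 <=
    (1 - tau) ^+ 2 * (Vx * th ^+ 4) - Vy * th ^+ 4.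
  have a1 : 0 <= (1 - tau) ^+ 2 * (Vx - Vy) * th ^+ 4.
    by apply: mulr_ge0 => //; apply: mulr_ge0; rewrite ?sqr_ge0 ?subr_ge0.
  have a2 : 0 <= (2 * tau - tau ^+ 2) * (k ^+ 2 - Vy) * th ^+ 4.
    have a3 : 0 <= 2 * tau - tau ^+ 2 by nra.
    by apply: mulr_ge0 => //; apply: mulr_ge0 => //; rewrite subr_ge0.
  by move: a1 a2; nra.
have th4m : th ^+ 4 <= m ^+ 2.
  have a : th ^+ 2 <= m by nra.
  have -> : th ^+ 4 = (th ^+ 2) ^+ 2 by ring.
  by rewrite ler_sqr ?nnegrE ?sqr_ge0// ltW.
have Hp : tau * (K ^+ 2 - k ^+ 2) * m ^+ 2 <=
   (2 * tau - tau ^+ 2) * (K ^+ 2 * m ^+ 2 - k ^+ 2 * th ^+ 4).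
  have a1 : k ^+ 2 * th ^+ 4 <= k ^+ 2 * m ^+ 2 by rewrite ler_wpM2l ?sqr_ge0.
  have a2 : 0 <= (K ^+ 2 - k ^+ 2) * m ^+ 2 by rewrite mulr_ge0 ?sqr_ge0//; nra.
  have a3 : tau <= 2 * tau - tau ^+ 2 by nra.
  rewrite -mulrA.
  apply: (@le_trans _ _ ((2 * tau - tau ^+ 2) * ((K ^+ 2 - k ^+ 2) * m ^+ 2))).
    by rewrite ler_wpM2r.
  by rewrite ler_wpM2l//; [apply: le_trans a3; rewrite ltW | rewrite mulrBl lerB].
(* Every remaining term is compared with Q = r m. *)
pose Q := t * m ^+ 2.
have Q0 : 0 < Q by rewrite mulr_gt0// exprn_gt0.
have H1 : - (2 * K ^+ 2 * d * Q) <= K ^+ 2 * (- 2 * r * m * C + r ^+ 2 * S).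
  rewrite rE /Q.
  have a1 : 0 <= K ^+ 2 * t * m ^+ 2 * (d - C).
    by nng.
  have a2 : 0 <= K ^+ 2 * (t * m) ^+ 2 * S by nng.
  by move: a1 a2; nra.
have H2 : - (2 * K * (lam + d) ^+ 2 * Q) <=
  2 * K * th * (- tau ^+ 2 * m + tau * m * C + r * tau * C - r * S).
  have b : - ((lam + d) ^+ 2 * (t * m)) <=
     - tau ^+ 2 * m + tau * m * C + r * tau * C - r * S.
    have -> : - tau ^+ 2 * m + tau * m * C + r * tau * C - r * S =
       (t * m) * (- (lam ^+ 2 * t) + lam * C + lam * t * C - S).
      by rewrite tauE rE; ring.
    rewrite mulrC -mulrN; apply: ler_wpM2l; first by nng.
    have c1 : lam ^+ 2 * t <= lam ^+ 2 by rewrite ler_piMr ?sqr_ge0.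
    have c2 : - (lam * d) <= lam * C by nra.
    have c3 : - (lam * d) <= lam * t * C.
      have c4 : lam * t * C >= - (lam * t * d) by nra.
      apply: le_trans c4; rewrite lerN2 ler_wpM2r// ler_piMr// ltW//.
    nra.
  have b2 : 0 <= (lam + d) ^+ 2 * (t * m) by nng.
  have b3 : 2 * K * th * - ((lam + d) ^+ 2 * (t * m)) <=
   2 * K * th * (- tau ^+ 2 * m + tau * m * C + r * tau * C - r * S).
    by apply: ler_wpM2l => //; nng.
  apply: le_trans b3; rewrite mulrN lerN2.
  have -> : 2 * K * (lam + d) ^+ 2 * Q = 2 * K * m * ((lam + d) ^+ 2 * (t * m)).
    by rewrite /Q; ring.
  by apply: ler_wpM2r => //; apply: ler_wpM2l => //; nng.
have H3 : N * K * th ^+ 2 * (tau ^+ 2 + 2 * eps * r) <=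
   N * K * (lam ^+ 2 + d ^+ 2 / 2) * Q.
  have NK : 0 <= N * K by nng.
  have -> : N * K * th ^+ 2 * (tau ^+ 2 + 2 * eps * r) =
    N * K * (th ^+ 2 * (tau ^+ 2 + 2 * eps * r)) by ring.
  rewrite -[leRHS]mulrA; apply: ler_wpM2l => //.
  have c0 : th ^+ 2 <= m ^+ 2 by rewrite ler_sqr// nnegrE ltW.
  have c1 : tau ^+ 2 + 2 * eps * r <= (lam ^+ 2 + d ^+ 2 / 2) * t.
    have e1 : tau ^+ 2 <= lam ^+ 2 * t.
      rewrite tauE exprMn ler_wpM2l ?sqr_ge0// expr2 ler_piMl// ltW//.
    have e2 : 2 * eps * r <= d ^+ 2 / 2 * t.
      have -> : d ^+ 2 / 2 * t = 2 * eps * t by rewrite -epsE; field.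
      rewrite rE; apply: ler_wpM2l; [by nng | by rewrite ler_piMr// ltW].
    nra.
  apply: (@le_trans _ _ (m ^+ 2 * ((lam ^+ 2 + d ^+ 2 / 2) * t))).
    apply: ler_pM => //; first exact: sqr_ge0.
    by nng.
  by rewrite /Q le_eqVlt; apply/orP; left; apply/eqP; ring.
have H4 : N * K * lam ^+ 2 * t * (th ^+ 3 / m) <= N * K * lam ^+ 2 * Q.
  rewrite /Q [leRHS]mulrA ler_wpM2l//.
    by nng.
  rewrite ler_pdivrMr//.
  have -> : m ^+ 2 * m = m ^+ 3 by ring.
  by rewrite lerXn2r// nnegrE ltW.
have H5 : lam * (K ^+ 2 - k ^+ 2) * Q <=
   (2 * K ^+ 2 * d + 2 * K * (lam + d) ^+ 2 + N * K * (lam ^+ 2 + d ^+ 2 / 2)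
    + N * K * lam ^+ 2) * Q.
  have -> : lam * (K ^+ 2 - k ^+ 2) * Q = tau * (K ^+ 2 - k ^+ 2) * m ^+ 2.
    by rewrite tauE /Q; ring.
  lra.
rewrite (ler_pM2r Q0) in H5.
have d2 : d ^+ 2 <= lam ^+ 2 by rewrite ler_sqr ?nnegrE// ltW.
have F1 : 2 * K * (lam + d) ^+ 2 <= 2 * K * (4 * lam ^+ 2).
  apply: ler_wpM2l; [by nng | nra].
have F2 : N * K * (lam ^+ 2 + d ^+ 2 / 2) <= N * K * (2 * lam ^+ 2).
  apply: ler_wpM2l; [by nng | nra].
have F3 : lam * (K ^+ 2 - k ^+ 2) <= lam * (lam * (2 * K ^+ 2 + 8 * K + 3 * N * K)).
  rewrite dE in H5 F1 F2 *; lra.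
by move: F3; rewrite ler_pM2l// leNgt lsmall.
Qed.

Lemma sum_affine6 (R : comPzRingType) (n : nat) (F G E1 E2 E3 : 'I_n -> R)
    (sF sG s1 s2 s3 c1 c2 c3 c4 c5 c6 : R) :
  \sum_i F i = sF -> \sum_i G i = sG ->
  \sum_i E1 i = s1 -> \sum_i E2 i = s2 -> \sum_i E3 i = s3 ->
  \sum_i (c1 * F i - c2 * G i + c3 * E1 i + c4 * E2 i - c5 * E3 i - c6) =
  c1 * sF - c2 * sG + c3 * s1 + c4 * s2 - c5 * s3 - n%:R * c6.
Proof.
move=> <- <- <- <- <-.
by rewrite !big_split/= !sumrN -!mulr_sumr sumr_const card_ord mulr_natl.
Qed.

(** The second-order condition for one coordinate, expanded in the products
    whose sums over the coordinates are known. *)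
Lemma second_order_sum_of_squares (R : comPzRingType)
    (th tau m A mu r e Y uxx uyy h : R) :
  th * (1 - tau) ^+ 2 * uxx - th * uyy
    + 2 * A * (- tau ^+ 2 * m) * e ^+ 2
    + 2 * A * (2 * mu ^+ 2 * (tau * m + r * tau)) * (e * Y)
    - 2 * A * (4 * mu ^+ 4 * r) * Y ^+ 2 - h
  = ((1 - tau) ^+ 2 * uxx - 1 ^+ 2 * uyy) * th
    + 2 * ((1 - tau) * (A * (m * e)) - 1 * (A * (m * e - 2 * mu ^+ 2 * r * Y)))
      * (- ((1 - tau - 1) * e) - 2 * mu ^+ 2 * 1 * Y) - h.
Proof. ring. Qed.

(** The step of y is s and that of x is (1 - tau) s with tau = lam r / m.
    With equal steps the two Laplacians would nearly cancel; the shorter step of x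
    brings in Lap u x, which is at most k^2 - K^2 < 0. *)
Lemma doubling_no_max (R : realType) (n : nat) (u V : 'rV[R]_n.+1 -> R)
    (k K lam : R) (y0 x y : 'rV[R]_n.+1) :
  let mu := lam ^+ 2 / 2 in
  0 <= k -> k < K -> 0 < lam -> lam <= 1 ->
  lam * (2 * K ^+ 2 + 8 * K + 3 * n.+1%:R * K) < K ^+ 2 - k ^+ 2 ->
  (forall i p, derivable u p (basis_vec R i)) ->
  (forall i p, derivable (partial i u) p (basis_vec R i)) ->
  (forall p, laplacian u p + \sum_i partial i u p ^+ 2 = V p) ->
  (forall p, V p <= k ^+ 2) ->
  (forall p q, k * euclidean_norm (p - q) <= u p - u q -> V q <= V p) ->
  0 < slack mu y0 x y -> 0 < doubling u K mu y0 x y ->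
  (forall i al be, \forall s \near (0 : R),
     doubling u K mu y0 (x + (al * s) *: basis_vec R i)
     (y + (be * s) *: basis_vec R i) <= doubling u K mu y0 x y) -> False.
Proof.
move=> mu k0 kK lam0 lam1 lamK du ddu eqV Vk Vmono th0 D0 nmax.
have K0 : 0 < K by exact: le_lt_trans kK.
pose r := euclidean_norm (x - y).
pose th := slack mu y0 x y; rewrite -/th in th0.
have r0 : 0 < r.
  rewrite lt_def euclidean_norm_ge0 andbT; apply/eqP => rE.
  move: D0; rewrite /doubling -/r rE mulr0 mul0r subr0.
  have -> : x = y.
    apply/eqP; rewrite -subr_eq0; apply/eqP/rowP => i; rewrite [RHS]mxE.
    apply/eqP; rewrite -normr_le0 -rE; exact: le_coord_euclidean_norm.
  by rewrite subrr ltxx.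
have rn : r != 0 by rewrite gt_eqF.
have thn : th != 0 by rewrite gt_eqF.
pose e i := (x - y) 0 i / r.
pose Y i := (y - y0) 0 i.
pose m := th + r.
have m0 : 0 < m by rewrite addr_gt0.
have mE : m = 1 - mu ^+ 2 * sqnorm (y - y0) by rewrite /m /th /slack -/r; ring.
have m1 : m <= 1 by rewrite mE gerBl mulr_ge0 ?sqr_ge0 ?sqnorm_ge0.
(* Positivity of the doubled function forces u x - u y > K r > k r. *)
have Vxy : V y <= V x.
  apply: Vmono; apply: (@le_trans _ _ (K * r / th)).
    rewrite ler_pdivlMr// -/r -mulrA [r * _]mulrC mulrA ler_wpM2r ?(ltW r0)//.
    have th1 : th <= 1 by apply: le_trans m1; rewrite /m lerDl ltW.
    by apply: le_trans (ltW kK); rewrite ler_piMr.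
  by move: D0; rewrite /doubling -/r -/th subr_gt0 => /ltW.
pose A := K / th ^+ 2.
(* Moving x alone, then y alone, gives the two gradients. *)
have pE i : partial i u x = A * (m * e i).
  have [+ _] := doubling_line_at_max K0 r0 th0 (du i) (ddu i) (nmax i 1 0).
  rewrite -/r -/th -/(e i) -/(Y i) => E.
  have {}E : partial i u x * th = K * e i + K * r / th * e i by rewrite /m; lra.
  apply: (mulIf thn); rewrite E /A /m; field; exact: thn.
have qE i : partial i u y = A * (m * e i - 2 * mu ^+ 2 * r * Y i).
  have [+ _] := doubling_line_at_max K0 r0 th0 (du i) (ddu i) (nmax i 0 1).
  rewrite -/r -/th -/(e i) -/(Y i) => E.
  have {}E : partial i u y * th =
     K * e i + K * r / th * (e i - 2 * mu ^+ 2 * Y i) by lra.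
  apply: (mulIf thn); rewrite E /A /m; field; exact: thn.
pose tau := lam * (r / m).
pose c := \sum_i e i * Y i.
pose sY := sqnorm (y - y0).
have see : \sum_i e i ^+ 2 = 1.
  under eq_bigr => i _ do rewrite /e exprMn.
  by rewrite -mulr_suml -/(sqnorm _) -sqr_euclidean_norm -/r -exprMn divff// expr1n.
have sYY : \sum_i Y i ^+ 2 = sY by [].
have ineq : \sum_i
   (th * (1 - tau) ^+ 2 * partial i (partial i u) x
    - th * partial i (partial i u) y
    + 2 * A * (- tau ^+ 2 * m) * e i ^+ 2
    + 2 * A * (2 * mu ^+ 2 * (tau * m + r * tau)) * (e i * Y i)
    - 2 * A * (4 * mu ^+ 4 * r) * Y i ^+ 2
    - K * (tau ^+ 2 + 2 * mu ^+ 2 * r) / th) <=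
   \sum_(i < n.+1) (K * tau ^+ 2 / r).
  apply: ler_sum => i _.
  have [_] := doubling_line_at_max K0 r0 th0 (du i) (ddu i) (nmax i (1 - tau) 1).
  rewrite -/r -/th -/(e i) -/(Y i) pE qE => E.
  have -> : K * tau ^+ 2 / r = 2 * K * ((1 - tau - 1) ^+ 2 / (2 * r)).
    by field.
  have h : 2 * (K * r / th) * ((1 - tau - 1) ^+ 2 / (2 * r)
      + mu ^+ 2 * 1 ^+ 2) = K * (tau ^+ 2 + 2 * mu ^+ 2 * r) / th.
    by field; rewrite thn rn.
  rewrite h in E.
  by rewrite second_order_sum_of_squares.
have c2 : (2 * mu ^+ 2 * c) ^+ 2 <= (lam ^+ 2) ^+ 2 /\ mu ^+ 2 * sY <= 1.
  have s1 : mu ^+ 2 * sY <= 1 by move: m0; rewrite mE -/sY; lra.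
  split=> //.
  have cs : c ^+ 2 <= sY.
    have := cauchy_schwarz_sqnorm (\row_i e i) (y - y0).
    have -> : sqnorm (\row_i e i) = 1.
      by rewrite -see; apply: eq_bigr => i _; rewrite mxE.
    rewrite mul1r; congr (_ ^+ 2 <= _); apply: eq_bigr => i _; by rewrite mxE.
  have -> : (lam ^+ 2) ^+ 2 = 4 * mu ^+ 2 by rewrite /mu; field.
  have -> : (2 * mu ^+ 2 * c) ^+ 2 = 4 * mu ^+ 2 * (mu ^+ 2 * c ^+ 2) by ring.
  apply: ler_piMr; first by rewrite mulr_ge0 ?sqr_ge0.
  by apply: le_trans s1; rewrite ler_wpM2l ?sqr_ge0.
have [c2a c2b] := c2.
apply: (@doubling_arith R n.+1%:R K k lam (lam ^+ 2) (mu ^+ 2) r m th tau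
   (2 * mu ^+ 2 * c) (4 * mu ^+ 4 * sY) (V x) (V y)) => //.
- by rewrite /mu; field.
- by rewrite -ler_norml -ler_sqr ?nnegrE ?sqr_ge0// -normrX ger0_norm ?sqr_ge0.
- apply/andP; split.
    have -> : mu ^+ 4 = (mu ^+ 2) ^+ 2 by ring.
    by apply: mulr_ge0; [exact: mulr_ge0 (ler0n _ _) (sqr_ge0 _) | exact: sqnorm_ge0].
  have -> : (lam ^+ 2) ^+ 2 = 4 * mu ^+ 2 by rewrite /mu; field.
  have -> : 4 * mu ^+ 4 * sY = 4 * mu ^+ 2 * (mu ^+ 2 * sY) by ring.
  by apply: ler_piMr => //; rewrite mulr_ge0 ?sqr_ge0.
have lapx : \sum_i partial i (partial i u) x = V x - K ^+ 2 * m ^+ 2 / th ^+ 4.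
  rewrite -(eqV x) /laplacian; suff -> : \sum_i partial i u x ^+ 2 =
    K ^+ 2 * m ^+ 2 / th ^+ 4 by rewrite addrK.
  transitivity (\sum_i K ^+ 2 * m ^+ 2 / th ^+ 4 * e i ^+ 2).
    by apply: eq_bigr => i _; rewrite pE /A; field.
  by rewrite -mulr_sumr see mulr1.
have lapy : \sum_i partial i (partial i u) y =
    V y - K ^+ 2 * (m ^+ 2 - 2 * r * m * (2 * mu ^+ 2 * c)
      + r ^+ 2 * (4 * mu ^+ 4 * sY)) / th ^+ 4.
  rewrite -(eqV y) /laplacian; suff -> : \sum_i partial i u y ^+ 2 = K ^+ 2 * (m ^+ 2
    - 2 * r * m * (2 * mu ^+ 2 * c) + r ^+ 2 * (4 * mu ^+ 4 * sY)) / th ^+ 4.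
    by rewrite addrK.
  transitivity (\sum_i (K ^+ 2 * m ^+ 2 / th ^+ 4 * e i ^+ 2
     - K ^+ 2 * 2 * r * m * 2 * mu ^+ 2 / th ^+ 4 * (e i * Y i)
     + K ^+ 2 * r ^+ 2 * 4 * mu ^+ 4 / th ^+ 4 * Y i ^+ 2)).
    by apply: eq_bigr => i _; rewrite qE /A; field.
  rewrite big_split/= sumrB -!mulr_sumr see sYY -/c; field; exact: thn.
rewrite (sum_affine6 _ _ _ _ _ _ lapx lapy see (erefl c) sYY) in ineq.
move: ineq.
rewrite sumr_const card_ord -[X in _ <= X -> _]mulr_natl.
have -> : n.+1%:R * (K * tau ^+ 2 / r) = n.+1%:R * K * tau ^+ 2 / r by ring.
rewrite -/A; apply: le_trans; rewrite le_eqVlt; apply/orP; left; apply/eqP.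
ring.
Qed.

(** * Gradient bounds *)

(** The parameter lam = g / (c + g), with g = K^2 - k^2 and c the constant of
    the losses, is less than 1 and satisfies lam c < g. *)
Lemma doubling_le0 (R : realType) (n : nat) (u V : 'rV[R]_n.+1 -> R)
    (k K : R) :
  0 <= k -> k < K -> continuous u ->
  (forall i p, derivable u p (basis_vec R i)) ->
  (forall i, continuous (partial i u)) ->
  (forall i p, derivable (partial i u) p (basis_vec R i)) ->
  (forall p, laplacian u p + \sum_i partial i u p ^+ 2 = V p) ->
  (forall p, V p <= k ^+ 2) ->
  (forall p q, k * euclidean_norm (p - q) <= u p - u q -> V q <= V p) ->
  exists mu, forall y0 x y,
    0 < slack mu y0 x y -> doubling u K mu y0 x y <= 0.
Proof.
move=> k0 kK cu du cdu ddu eqV Vk Vmono.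
have K0 : 0 < K by exact: le_lt_trans kK.
pose gap := K ^+ 2 - k ^+ 2.
have gap0 : 0 < gap by rewrite subr_gt0 ltr_sqr ?nnegrE// ltW.
pose c0 := 2 * K ^+ 2 + 8 * K + 3 * n.+1%:R * K.
have c00 : 0 < c0 by rewrite !addr_gt0 ?mulr_gt0 ?exprn_gt0.
pose lam := gap / (c0 + gap).
have cg0 : 0 < c0 + gap by rewrite addr_gt0.
have lam0 : 0 < lam by rewrite divr_gt0.
have lam1 : lam <= 1 by rewrite ler_pdivrMr// mul1r lerDr ltW.
have lamc : lam * c0 < gap.
  by rewrite /lam mulrAC ltr_pdivrMr// ltr_pM2l// ltrDl.
have mu0 : 0 < lam ^+ 2 / 2 by rewrite divr_gt0// exprn_gt0.
exists (lam ^+ 2 / 2) => y0 x1 y1 s1; rewrite leNgt; apply/negP => D1.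
have [x [y [sxy Dxy nmax]]] := doubling_max_exists K0 mu0 cu du cdu s1 D1.
apply: (@doubling_no_max R n u V k K lam y0 x y) => // i al be.
have cl (z : 'rV[R]_n.+1) (c : R) :
    z + (c * s) *: basis_vec R i @[s --> (0 : R)] --> z.
  rewrite -[X in _ --> X]addr0; apply: cvgD; first exact: cvg_cst.
  rewrite -[X in _ --> X](scale0r (basis_vec R i)); apply: cvgZr_tmp.
  rewrite -[X in _ --> X](mulr0 c); apply: cvgMl_tmp; exact: cvg_id.
exact: (cvg_pair (cl x al) (cl y be) nmax).
Qed.

(** A Lipschitz estimate by comparison with cones: the doubling bound at
    y = y0 says that u lies below a cone of slope nearly K with vertex at y0.
    The hypothesis that relates V to u replaces any regularity of V. *)
Lemma euclidean_norm_grad_le (R : realType) (n : nat) (u V : 'rV[R]_n.+1 -> R)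
    (k : R) :
  0 <= k -> continuous u ->
  (forall i p, derivable u p (basis_vec R i)) ->
  (forall i, continuous (partial i u)) ->
  (forall i p, derivable (partial i u) p (basis_vec R i)) ->
  (forall p, laplacian u p + \sum_i partial i u p ^+ 2 = V p) ->
  (forall p, V p <= k ^+ 2) ->
  (forall p q, k * euclidean_norm (p - q) <= u p - u q -> V q <= V p) ->
  forall x, euclidean_norm (grad u x) <= k.
Proof.
move=> k0 cu du cdu ddu eqV Vk Vmono x0.
rewrite leNgt; apply/negP; set p := grad u x0; set G := euclidean_norm p => kG.
pose K := (k + G) / 2.
have kK : k < K by rewrite /K; lra.
have KG : K < G by rewrite /K; lra.
have K0 : 0 < K by exact: le_lt_trans kK.
have G0 : 0 < G by exact: lt_trans KG.
have [mu dle] := doubling_le0 k0 kK cu du cdu ddu eqV Vk Vmono.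
have [dp dpE] := is_derive_gradient x0 p du cdu.
have {}dpE : 'D_p u x0 = G ^+ 2.
  by rewrite dpE /G sqr_euclidean_norm; apply: eq_bigr => i _; rewrite /p mxE -expr2.
have : (fun h : R => h^-1 *: ((u \o shift x0) (h *: p) - u x0)) @ 0^' --> G ^+ 2.
  by rewrite -dpE; exact: dp.
(* The difference quotient along p tends to G^2 > K G, and the doubling bound
   keeps it below K G / (1 - h G); any h < q makes the two incompatible. *)
pose b := G * ((G + K) / 2).
have bG : b < G ^+ 2 by rewrite /b expr2 ltr_pM2l//; lra.
move/cvgr_gt => /(_ _ bG); rewrite near_withinE => /nbhs_ballP[d /= d0 dP].
pose q := (1 - 2 * K / (G + K)) / G.
have GK0 : 0 < G + K by rewrite addr_gt0.
have q0 : 0 < q.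
  by rewrite divr_gt0// subr_gt0 ltr_pdivrMr//; lra.
pose h := Num.min d q / 2.
have mn0 : 0 < Num.min d q by rewrite lt_min d0.
have h0 : 0 < h by rewrite divr_gt0.
have hm : h < Num.min d q by rewrite /h; lra.
have hd : h < d by apply: (lt_le_trans hm); rewrite ge_min lexx.
have hq : h < q by apply: (lt_le_trans hm); rewrite ge_min lexx orbT.
have hG : 2 * K / (G + K) < 1 - h * G by move: hq; rewrite /q ltr_pdivlMr//; lra.
have hG0 : 0 < 1 - h * G by apply: le_lt_trans hG; rewrite divr_ge0 ?ltW// mulr_gt0.
have nhp : euclidean_norm (x0 + h *: p - x0) = h * G.
  rewrite addrC addKr /euclidean_norm -/(sqnorm (h *: p)) sqnormZ sqrtrM ?sqr_ge0//.
  by rewrite sqrtr_sqr gtr0_norm.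
have slE : slack mu x0 (x0 + h *: p) x0 = 1 - h * G.
  by rewrite /slack nhp subrr sqnorm0 mulr0 subr0.
have := dle x0 (x0 + h *: p) x0; rewrite slE => /(_ hG0).
rewrite /doubling slE nhp subr_le0 => le1.
have := dP h; rewrite /ball/= sub0r normrN gtr0_norm// => /(_ hd).
rewrite gt_eqF// => /(_ isT); rewrite [_ + x0]addrC /GRing.scale/= mulrC ltr_pdivlMr//.
move=> /lt_le_trans /(_ le1); rewrite /b ltr_pdivlMr// => le2.
have : 2 * K < (1 - h * G) * (G + K) by rewrite -ltr_pdivrMr.
have hGp : 0 < h * G by rewrite mulr_gt0.
by move: le2 hGp; nra.
Qed.

(** Removing the drift by the factor exp (k y_n), with 2 k = eta, turns the
    bound |grad v| <= eta v into a bound by k of the gradient of u. *)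
Lemma grad_le_of_elliptic (R : realType) (n : nat) (a b eta : R)
    (v : 'rV[R]_n.+1 -> R) :
  0 < a -> 0 < b -> 0 <= eta -> (forall y, 0 < v y) -> continuous v ->
  (forall i y, derivable v y (basis_vec R i)) ->
  (forall i, continuous (partial i v)) ->
  (forall i y, derivable (partial i v) y (basis_vec R i)) ->
  (forall y, laplacian v y - eta * partial ord_max v y + a * v y
     - b * v y ^+ 3 = 0) ->
  forall y, euclidean_norm (grad v y) <= v y * eta.
Proof.
move=> a0 b0 eta0 v0 cv dv cdv ddv eqv y.
have vle := sqr_le_of_elliptic a0 b0 eta0 v0 cv dv ddv eqv.
pose k := eta / 2.
have k0 : 0 <= k by rewrite divr_ge0.
have etaE : eta = 2 * k by rewrite /k; field.
have vn z : v z != 0 by rewrite gt_eqF.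
pose u (z : 'rV[R]_n.+1) : R := ln (v z) - k * z 0 ord_max.
pose dl (i : 'I_n.+1) : R := (i == ord_max)%:R.
have d2 i : dl i ^+ 2 = dl i.
  by rewrite /dl; case: (_ == _); rewrite ?expr1n ?expr0n.
have sdl (F : 'I_n.+1 -> R) : \sum_i dl i * F i = F ord_max.
  rewrite (bigD1 ord_max)//= /dl eqxx mul1r big1 ?addr0// => i /negPf ->.
  by rewrite mul0r.
have sdl1 : \sum_i dl i = 1.
  by rewrite -[RHS](sdl (fun=> 1)); apply: eq_bigr => i _; rewrite mulr1.
pose V (z : 'rV[R]_n.+1) : R := k ^+ 2 - a + b * v z ^+ 2.
have du i z : is_derive z (basis_vec R i) u (partial i v z / v z - k * dl i).
  exact: is_deriveB (is_derive_ln_comp (v0 z) (dv i z))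
    (is_deriveZ k (is_derive_coord i ord_max z)).
have uiE i : partial i u = fun z => partial i v z / v z - k * dl i.
  by apply/funext => z; have [_ <-] := du i z.
have ddu i z : is_derive z (basis_vec R i) (partial i u)
    (partial i (partial i v) z / v z - (partial i v z / v z) ^+ 2).
  have dvi : is_derive z (basis_vec R i) v (partial i v z).
    by apply: DeriveDef => //; exact: dv.
  have dinv : is_derive z (basis_vec R i) (fun y => (v y)^-1)
      (- (v z) ^- 2 *: partial i v z).
    apply: DeriveDef; first exact: derivableV.
    by rewrite deriveV.
  have dvii : is_derive z (basis_vec R i) (partial i v) (partial i (partial i v) z).
    by apply: DeriveDef => //; exact: ddv.
  rewrite uiE.
  apply: is_derive_eq
    (is_deriveB (is_deriveM dvii dinv) (is_derive_cst (k * dl i) z _)) _.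
  by rewrite /GRing.scale/=; field; exact: vn.
have cln : continuous (fun z => ln (v z)).
  move=> z; apply: (@continuous_comp _ _ _ v (@ln R)); first exact: cv.
  exact: continuous_ln.
have cco : continuous (fun z : 'rV[R]_n.+1 => z 0 ord_max).
  by move=> z; exact: coord_continuous.
have cu : continuous u.
  by move=> z; exact: (cvgB (cln z) (cvgMl_tmp (cco z))).
have cdu i : continuous (partial i u).
  rewrite uiE => z.
  exact: (cvgB (cvgM (cdv i z) (cvgV (vn z) (cv z))) (cvg_cst (k * dl i))).
have eqV z : laplacian u z + \sum_i partial i u z ^+ 2 = V z.
  rewrite /laplacian -big_split/=.
  have -> : \sum_i (partial i (partial i u) z + partial i u z ^+ 2) =
    \sum_i (partial i (partial i v) z * (v z)^-1
      + (- 2 * k / v z) * (dl i * partial i v z) + k ^+ 2 * dl i).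
    apply: eq_bigr => i _; have [_ e2] := ddu i z.
    rewrite {1}/partial e2 uiE.
    rewrite -[in X in _ + k ^+ 2 * X]d2; field; exact: vn.
  rewrite !big_split/= -!mulr_sumr -mulr_suml sdl sdl1.
  rewrite -/(laplacian v z).
  have -> : laplacian v z = eta * partial ord_max v z - a * v z + b * v z ^+ 3.
    by have := eqv z; lra.
  by rewrite /V etaE; field; exact: vn.
have Vk z : V z <= k ^+ 2 by have := vle z; rewrite /V; lra.
have Vmono p q : k * euclidean_norm (p - q) <= u p - u q -> V q <= V p.
  move=> h; have vqp : v q <= v p.
    rewrite -ler_ln ?posrE// -subr_ge0.
    have := le_coord_euclidean_norm (p - q) ord_max.
    rewrite ler_norml => /andP[h1 _].
    have := ler_wpM2l k0 h1; move: h; rewrite /u !mxE; lra.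
  have vq0 := ltW (v0 q); have vp0 := ltW (v0 p).
  by rewrite /V lerD2l ler_pM2l// ler_sqr ?nnegrE.
have du' i p : derivable u p (basis_vec R i) by have [] := du i p.
have ddu' i p : derivable (partial i u) p (basis_vec R i) by have [] := ddu i p.
have ule := euclidean_norm_grad_le k0 cu du' cdu ddu' eqV Vk Vmono y.
have gule : sqnorm (grad u y) <= k ^+ 2.
  by rewrite -sqr_euclidean_norm ler_sqr ?nnegrE ?euclidean_norm_ge0.
have unle : partial ord_max u y <= k.
  apply: le_trans ule; apply: le_trans (le_coord_euclidean_norm _ ord_max).
  by rewrite mxE ler_norm.
have vuE i : partial i v y = v y * (partial i u y + k * dl i).
  by rewrite uiE subrK mulrCA divff ?mulr1.
have vy0 := ltW (v0 y).
rewrite -ler_sqr ?nnegrE ?euclidean_norm_ge0 ?mulr_ge0//.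
rewrite sqr_euclidean_norm exprMn.
have -> : sqnorm (grad v y) =
   v y ^+ 2 * (sqnorm (grad u y) + 2 * k * partial ord_max u y + k ^+ 2).
  transitivity (\sum_i (v y ^+ 2 * (grad u y 0 i) ^+ 2
     + v y ^+ 2 * 2 * k * (dl i * partial i u y) + v y ^+ 2 * k ^+ 2 * dl i)).
    apply: eq_bigr => i _; rewrite !mxE vuE -[in X in _ = _ + X]d2; ring.
  rewrite !big_split/= -!mulr_sumr sdl sdl1 /sqnorm; ring.
apply: ler_wpM2l; first exact: sqr_ge0.
rewrite etaE; nra.
Qed.

Theorem corollary4p3 (R : realType) (n : nat) (a b eta : R)
    (v : 'rV[R]_n.+1 -> R) (f : 'rV[R]_n.+1 -> R -> R)
    (a_gt0 : 0 < a) (b_gt0 : 0 < b)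
    (* a wavespeed is nonnegative; for f = v = sqrt (a / b) every real eta
       would otherwise be allowed *)
    (eta_ge0 : 0 <= eta)
    (f_sol : positive_solution a b f)
    (f_wave : traveling_wave eta v f) :
  forall y : 'rV[R]_n.+1, euclidean_norm (grad v y) <= v y * eta.
Proof.
have [[[dfx dfxx dft cf cfx _ _] f_eq] f_gt0] := f_sol.
pose e : 'rV[R]_n.+1 := basis_vec R ord_max.
pose w (x : 'rV[R]_n.+1) : R := f x 1.
pose c : 'rV[R]_n.+1 := - (eta *: e).
have vE : v = fun y => w (y + c).
  apply/funext => y; rewrite /w f_wave// mulr1 /c subrK//.
have dv i y : is_derive y (basis_vec R i) v (partial i w (y + c)).
  by rewrite vE; apply: is_derive_translate; exact: (dfx i _ 1 ltr01).
have pvE i : partial i v = fun y => partial i w (y + c).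
  by apply/funext => y; have [_ <-] := dv i y.
have ddv i j y : is_derive y (basis_vec R j) (partial i v)
    (partial j (partial i w) (y + c)).
  by rewrite pvE; apply: is_derive_translate; exact: (dfxx i j _ 1 ltr01).
have cshift (g : 'rV[R]_n.+1 -> R) : continuous g ->
    continuous (fun y : 'rV[R]_n.+1 => g (y + c)).
  move=> cg y; apply: (@continuous_comp _ _ _ (fun y : 'rV[R]_n.+1 => y + c) g).
    exact: (cvgD (@cvg_id _ (nbhs y)) (cvg_cst c)).
  exact: cg.
have cslice (F : 'rV[R]_n.+1 * R -> R) :
    (forall x t, 0 < t -> {for (x, t), continuous F}) ->
    continuous (fun x => F (x, (1 : R))).
  move=> cF x.
  apply: (@continuous_comp _ _ _ (fun x : 'rV[R]_n.+1 => (x, (1 : R))) F).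
    exact: (cvg_pair (@cvg_id _ (nbhs x)) (cvg_cst (1 : R))).
  exact: cF.
apply: (@grad_le_of_elliptic R n a b eta v) => //.
- by move=> y; rewrite vE; exact: (f_gt0 _ 1 ler01).
- by rewrite vE; apply: cshift; apply: (cslice (fun p => f p.1 p.2)); exact: cf.
- move=> i; rewrite pvE; apply: cshift.
  by apply: (cslice (fun p => partial i (f^~ p.2) p.1)); exact: cfx.
move=> y.
have lapE : laplacian v y = laplacian w (y + c).
  by apply: eq_bigr => i _; have [_ <-] := ddv i i y.
have vtE : derive1 (f (y + c)) 1 = eta * partial ord_max v y.
  rewrite derive1E.
  have near_eq : \forall t \near (1 : R), f (y + c) t = v ((y + c) + (eta * t) *: e).
    near=> t; apply: f_wave; apply: ltW.
    by near: t; exact: lt_nbhsr.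
  rewrite (near_eq_derive _ near_eq).
  have := @is_derive_line R _ v (y + c) e eta 1.
  rewrite mulr1 /c subrK => /(_ _)[|_ ->//].
  by have [] := dv ord_max y.
have vyE : v y = f (y + c) 1 by rewrite vE.
have := f_eq (y + c) 1 ltr01.
rewrite vtE lapE vyE => ->; rewrite -/w; ring.
Unshelve. all: by end_near. Qed.
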